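(* Let $\mathfrak{S}$ be an equicontractive RIFS of finite type. There exists an essential class (of characteristic vectors of $\mathfrak{S}$), and it is unique.
   Context: Setting. Let $m\ge1$, $\mathcal{A}=\{1,\dots,m\}$, $\Omega=\mathcal{A}^{\mathbb{N}}$. For each $j\in\mathcal{A}$ let $\mathfrak{S}_j=\{S_{j,k}:k\in\mathcal{I}_j\}$, $\mathcal{I}_j=\{0,\dots,\mathcal{N}(j)\}$, with $S_{j,k}(x)=rx+d_{j,k}$ on $\mathbb{R}$ and one common ratio $0<r<1$; $\mathfrak{S}=\{\mathfrak{S}_1,\dots,\mathfrak{S}_m\}$ is an equicontractive RIFS. With $\mathfrak{S}_j(K)=\bigcup_kS_{j,k}(K)$, the attractor is $K_\omega=\lim_n\mathfrak{S}_{\omega_1}\circ\dots\circ\mathfrak{S}_{\omega_n}(K)$ (Hausdorff metric, any non-empty compact $K$). Standing assumption: the convex hull of $K_\omega$ is $[0,1]$ for every $\omega\in\Omega$. Put $\Lambda_{\omega,n}=\{(\sigma_1,\dots,\sigma_n):\sigma_i\in\mathcal{I}_{\omega_i}\}$ and $S_{\omega,\sigma}=S_{\omega_1,\sigma_1}\circ\dots\circ S_{\omega_n,\sigma_n}$. Finite type: there is a finite set $F$ such that for all $n\in\mathbb{N}$, $\omega\in\Omega$, $\sigma,\tau\in\Lambda_{\omega,n}$, either $|S_{\omega,\sigma}(0)-S_{\omega,\tau}(0)|r^{-n}>1$ or $(S_{\omega,\sigma}(0)-S_{\omega,\tau}(0))r^{-n}\in F$. Net intervals: for $n\ge1$ let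 $h_1<\dots<h_{s_n}$ be the elements of $\{S_{\omega,\sigma}(z):z\in\{0,1\},\sigma\in\Lambda_{\omega,n}\}$; the $\omega$-net intervals of level $n$ are the $[h_i,h_{i+1}]$ with $(h_i,h_{i+1})\cap K_\omega\neq\emptyset$; $[0,1]$ is the only net interval of level $0$. Each net interval $\Delta$ of level $n\ge1$ lies in a unique net interval of level $n-1$, its parent ($\Delta$ is its child). For $\Delta=[a,b]$ of level $n$: normalized length $\ell_n(\Delta)=r^{-n}(b-a)$; neighbour set $V_n^\omega(\Delta)=(a_1,\dots,a_J)$, the increasing list of the distinct numbers $r^{-n}(a-S_{\omega,\sigma}(0))$ over $\sigma\in\Lambda_{\omega,n}$ with $\Delta\subseteq S_{\omega,\sigma}([0,1])$; $t_n(\Delta)=t$ if $\Delta$ is the $t$-th from the left among the children of its parent having the same normalized length and neighbour set as $\Delta$ (and $t_0([0,1])=1$). The characteristic vector of $\Delta$ is $(\ell_n(\Delta),V_n^\omega(\Delta),t_n(\Delta))$; the set of characteristic vectors of $\mathfrak{S}$ is taken over all $\omega$, $n$, $\Delta$. Paths: for $\nu=(\nu_1,\dots,\nu_k)\in\mathcal{A}^k$, a sequence of characteristic vectors $\gamma=\gamma_0,\dots,\gamma_k=\beta$ is an admissible $\nu$-path linking $\gamma$ to $\beta$ if there are $\omega\in\Omega$ and $N$ with $\omega_{N+i}=\nu_i$ for $i=1,\dots,k$, and $\omega$-net intervals $\Delta_i$ of level $N+i$ ($i=0,\dots,k$) with characteristic vectors $\gamma_i$ such that each $\Delta_i$ is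 a child of $\Delta_{i-1}$. An admissible path is an admissible $\nu$-path for some finite word $\nu$; then $\beta$ is a descendant of $\gamma$, and a child of $\gamma$ if there is such a path of length one. Essential class: a non-empty set $\mathcal{L}$ of characteristic vectors is a loop class if for all $\gamma,\beta\in\mathcal{L}$ there is an admissible path $\gamma=\gamma_0,\dots,\gamma_k=\beta$ linking $\gamma$ to $\beta$ with every $\gamma_i\in\mathcal{L}$. A loop class $\mathcal{L}$ is an essential class if every child of every member of $\mathcal{L}$ is in $\mathcal{L}$. *)

(* Defs.v *)
From HB Require Import structures.
From mathcomp Require Import all_boot all_order all_algebra.
From mathcomp Require Import all_classical all_reals all_analysis.

Set Implicit Arguments.
Unset Strict Implicit.
Unset Printing Implicit Defensive.

Import Order.TTheory GRing.Theory Num.Theory.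
Import numFieldNormedType.Exports.

Local Open Scope classical_set_scope.
Local Open Scope ring_scope.

(* S_{j,k}(x) = rifs_ratio * x + trans j k for j : 'I_m and k in I_j = {0, ..., maxidx j};
   the values of trans j beyond maxidx j are never used. *)
Record equicontractive_rifs (R : realType) (m : nat) := EquicontractiveRIFS {
  rifs_ratio : R ;
  rifs_ratio_gt0 : 0 < rifs_ratio ;
  rifs_ratio_lt1 : rifs_ratio < 1 ;
  maxidx : 'I_m -> nat ;
  trans : 'I_m -> nat -> R }.

(* Alphabet sequences are indexed from 0: omega_(i+1) in the usual 1-based
   numbering is omega i. *)
Definition shift_seq (T : Type) (omega : nat -> T) : nat -> T := fun i => omega i.+1.

Definition hausdorff_dist (R : realType) (A B : set R) : \bar R :=
  maxe (ereal_sup [set edist_inf B a | a in A])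
       (ereal_sup [set edist_inf A b | b in B]).

Section RIFS.
Context {R : realType} {m : nat} (S : equicontractive_rifs R m).
Local Notation r := (rifs_ratio S).
Implicit Types (omega : nat -> 'I_m) (D P : R * R).

Definition similitude (j : 'I_m) (k : nat) (x : R) : R := r * x + trans S j k.

Definition ifs_image (j : 'I_m) (K : set R) : set R :=
  \bigcup_(k in [set k | (k <= maxidx S j)%N]) (similitude j k @` K).

Fixpoint rifs_image omega (n : nat) (K : set R) : set R :=
  if n is n'.+1 then ifs_image (omega 0%N) (rifs_image (shift_seq omega) n' K) else K.

Definition is_attractor omega (K : set R) : Prop :=
  [/\ compact K, K !=set0 &
      forall K0 : set R, compact K0 -> K0 !=set0 ->
        hausdorff_dist (rifs_image omega n K0) K @[n --> \oo] --> 0%E].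

(* Should no limit exist, this is set0, which full_hull excludes. *)
Definition attractor omega : set R := xget set0 [set K | is_attractor omega K].

Definition full_hull : Prop :=
  forall omega, smallest (@convex_set R R^o) (attractor omega) = `[0, 1]%classic.

(* Enumerates Lambda_{omega,n}. *)
Fixpoint words omega (n : nat) : seq (seq nat) :=
  if n is n'.+1 then
    [seq k :: s | k <- iota 0%N (maxidx S (omega 0%N)).+1, s <- words (shift_seq omega) n']
  else [:: [::]].

Fixpoint word_map omega (sigma : seq nat) (x : R) : R :=
  if sigma is k :: s then similitude (omega 0%N) k (word_map (shift_seq omega) s x) else x.

Definition finite_type : Prop :=
  exists F : set R, finite_set F /\
    forall (n : nat) omega (sigma tau : seq nat),
      sigma \in words omega n -> tau \in words omega n ->
      1 < `|word_map omega sigma 0 - word_map omega tau 0| * r ^- n \/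
      F ((word_map omega sigma 0 - word_map omega tau 0) * r ^- n).

Definition endpoints omega (n : nat) : seq R :=
  sort <=%R (undup [seq word_map omega sigma z | sigma <- words omega n, z <- [:: 0; 1]]).

(* A compact interval [a, b] is represented by the pair (a, b). The net intervals
   of a given level are listed from left to right. *)
Definition net_intervals omega (n : nat) : seq (R * R) :=
  if n is _.+1 then
    let h := endpoints omega n in
    [seq D <- zip h (behead h) | `[< `]D.1, D.2[%classic `&` attractor omega !=set0 >]]
  else [:: (0, 1)].

Definition subitv D P : bool :=
  `[< `[D.1, D.2]%classic `<=` `[P.1, P.2]%classic >].

(* For P of level n, the children of P from left to right; they have level n+1. *)
Definition children omega (n : nat) P : seq (R * R) :=
  [seq D <- net_intervals omega n.+1 | subitv D P].

(* For D of level n+1, the net interval of level n containing D. *)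
Definition parent omega (n : nat) D : R * R :=
  head (0, 1) [seq P <- net_intervals omega n | subitv D P].

Definition norm_length (n : nat) D : R := r ^- n * (D.2 - D.1).

Definition neighbour_set omega (n : nat) D : seq R :=
  sort <=%R (undup
    [seq r ^- n * (D.1 - word_map omega sigma 0) |
      sigma <- words omega n &
      `[< `[D.1, D.2]%classic `<=` word_map omega sigma @` `[0, 1]%classic >]]).

Definition position omega (n : nat) D : nat :=
  if n is n'.+1 then
    (index D [seq D' <- children omega n' (parent omega n' D) |
                (norm_length n D' == norm_length n D) &&
                (neighbour_set omega n D' == neighbour_set omega n D)]).+1
  else 1%N.

Definition char_vector : Type := (R * seq R * nat)%type.

Definition char_vec omega (n : nat) D : char_vector :=
  (norm_length n D, neighbour_set omega n D, position omega n D).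

Definition char_vectors : set char_vector :=
  [set gamma | exists omega (n : nat) D,
    D \in net_intervals omega n /\ gamma = char_vec omega n D].

(* The list g is gamma_0, ..., gamma_k where k = size nu. *)
Definition admissible_word_path (nu : seq 'I_m) (g : seq char_vector) : Prop :=
  size g = (size nu).+1 /\
  exists (omega : nat -> 'I_m) (N : nat) (Delta : nat -> R * R),
    [/\ forall i, (i < size nu)%N -> onth nu i = Some (omega (N + i)%N),
        forall i, (i <= size nu)%N ->
          Delta i \in net_intervals omega (N + i)%N /\
          onth g i = Some (char_vec omega (N + i)%N (Delta i)) &
        forall i, (i < size nu)%N ->
          Delta i.+1 \in children omega (N + i)%N (Delta i)].

(* Words of length 0 are excluded, as usual for loop classes: a single vector
   is a loop class only if it is a child of itself. *)
Definition admissible_path (g : seq char_vector) : Prop :=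
  exists nu : seq 'I_m, (0 < size nu)%N /\ admissible_word_path nu g.

Definition is_child (gamma beta : char_vector) : Prop :=
  admissible_path [:: gamma; beta].

Definition loop_class (L : set char_vector) : Prop :=
  [/\ L `<=` char_vectors, L !=set0 &
      forall gamma beta, L gamma -> L beta ->
        exists g : seq char_vector,
          [/\ admissible_path (gamma :: g), last gamma g = beta &
              forall x, x \in gamma :: g -> L x]].

Definition essential_class (L : set char_vector) : Prop :=
  loop_class L /\ forall gamma beta, L gamma -> is_child gamma beta -> L beta.

End RIFS.

(* Main.v *)
Require Import Defs.
From mathcomp Require Import all_boot all_order all_algebra.
From mathcomp Require Import all_classical all_reals all_analysis.
From mathcomp Require Import ring lra.

(** What lies inside a net interval D of level n, at level n and beyond, is a
    rescaled picture determined by the normalized length of D, its neighbour set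
    and the tail (omega_(n+1), omega_(n+2), ...): the copies S_sigma([0,1]) of
    level n that overlap the interior of D all contain D (cell_covered), and the
    finer endpoints and the attractor points inside D come from these copies.
    Two intervals that agree in these data are called similar below; the affine
    map between them carries net intervals, neighbour sets and characteristic
    vectors of all deeper levels to each other (char_vec_similar).

    Two admissible paths, gamma to beta and beta to eta, may come from different
    sequences omega. They can still be concatenated: cut the first sequence where
    it reaches beta, and continue with the tail that the second path sees
    (splice_similar). This changes the tail, hence possibly which gaps are net
    intervals, but not the characteristic vectors of the first path: among
    siblings with equal length and neighbour set, either all or none meet the
    new attractor, so positions are unaffected (char_vec_prefix). So being a
    descendant is a transitive relation (descendant_trans).

    It remains to find a vector delta that is a descendant of every vector.
    Finite type bounds the size of neighbour sets, so there is a net interval P0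
    with the largest number of neighbours. Every net interval P contains a copy
    S_sigma([0,1]); continue sigma with the sequence of P0. Then S_sigma(P0) is
    similar to P0 (maximal_copy_similar), because a further copy overlapping it
    would yield, within S_sigma(P0), a net interval with more neighbours than P0.
    The position of S_sigma(P0) among its siblings may differ from that of P0, so
    the characteristic vectors of the two can be different; those of their
    children agree, and delta is the vector of a child of P0.

    The descendants of delta form an essential class. Conversely an essential
    class contains delta, since it is closed under descendants, so it contains
    all descendants of delta; and nothing else, since it is a loop class. *)

Set Implicit Arguments.
Unset Strict Implicit.
Unset Printing Implicit Defensive.

Import Order.TTheory GRing.Theory Num.Theory.
Import numFieldNormedType.Exports.

Local Open Scope classical_set_scope.
Local Open Scope ring_scope.

(** * Translation parts of the level-n maps *)

Section Translations.
Context {R : realType} {m : nat} (S : equicontractive_rifs R m).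
Local Notation r := (rifs_ratio S).
Implicit Types (w : nat -> 'I_m) (n k : nat).

Definition tail n w : nat -> 'I_m := fun i => w (n + i)%N.

Definition splice n w w' : nat -> 'I_m :=
  fun i => if (i < n)%N then w i else w' (i - n)%N.

Definition translations w n : seq R :=
  [seq word_map S w s 0 | s <- words S w n].

Lemma tail_splice n w w' : tail n (splice n w w') = w'.
Proof.
apply/funext => i; rewrite /tail /splice ltnNge leq_addr /=.
by rewrite addnC addnK.
Qed.

Lemma splice_prefix n w w' i : (i < n)%N -> splice n w w' i = w i.
Proof. by rewrite /splice => ->. Qed.

Lemma tail_tail n k w : tail k (tail n w) = tail (n + k) w.
Proof. by apply/funext => i; rewrite /tail addnA. Qed.

Let r_gt0 : 0 < r := rifs_ratio_gt0 S.
Let r_lt1 : r < 1 := rifs_ratio_lt1 S.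

Lemma ratio_expn_gt0 n : 0 < r ^+ n.
Proof. by rewrite exprn_gt0. Qed.

Lemma ratio_expn_small (e : R) : 0 < e -> exists k, r ^+ k < e.
Proof.
move=> e0; have : `|r| < 1 by rewrite gtr0_norm.
move=> /cvg_expr /cvgrPdist_lt /(_ e e0) [k _ /(_ k (leqnn k))].
rewrite sub0r normrN gtr0_norm ?ratio_expn_gt0 // => h.
by exists k.
Qed.

Lemma wordsS w n s :
  s \in words S w n.+1 <->
  exists i t, [/\ (i <= maxidx S (w 0%N))%N, t \in words S (tail 1 w) n & s = i :: t].
Proof.
split.
  move/allpairsPdep => [i [t [ii tt ->]]]; exists i, t; split=> //.
  by move: ii; rewrite (mem_iota 0 (maxidx S (w 0)).+1) add0n ltnS.
case=> i [t [ii tt ->]]; apply/allpairsPdep; exists i, t; split => //.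
by rewrite (mem_iota 0 (maxidx S (w 0)).+1) add0n ltnS.
Qed.

Lemma word_mapE w n s x :
  s \in words S w n -> word_map S w s x = r ^+ n * x + word_map S w s 0.
Proof.
elim: n w s => [|n IHn] w s.
  by rewrite inE => /eqP -> /=; rewrite expr0 mul1r addr0.
move=> /wordsS[i [t [_ /IHn ht ->]]] /=.
by rewrite /similitude ht exprS; ring.
Qed.

Lemma translationsS w n c :
  c \in translations w n.+1 <->
  exists i c', [/\ (i <= maxidx S (w 0%N))%N, c' \in translations (tail 1 w) n &
                   c = r * c' + trans S (w 0%N) i].
Proof.
split.
  case/mapP => s /wordsS[i [t [ii tt ->]]] ->.
  by exists i, (word_map S (tail 1 w) t 0); split => //; apply/mapP; exists t.
case=> i [c' [ii /mapP[t tt ->] ->]]; apply/mapP; exists (i :: t) => //.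
by apply/wordsS; exists i, t.
Qed.

(** A word of length n + k is a word of length n followed by one of length k. *)
Lemma translations_cat w n k c :
  c \in translations w (n + k) <->
  exists c1 c2, [/\ c1 \in translations w n, c2 \in translations (tail n w) k &
                    c = c1 + r ^+ n * c2].
Proof.
elim: n w c => [|n IHn] w c.
  split.
    by move=> hc; exists 0, c; rewrite inE eqxx expr0 mul1r add0r.
  by case=> c1 [c2 [/[!inE]/eqP -> hc ->]]; rewrite add0r expr0 mul1r.
rewrite addSn; split.
  case/translationsS => i [c' [ii /IHn[c1 [c2 [h1 h2 ->]]] ->]].
  exists (r * c1 + trans S (w 0%N) i), c2; split => //.
    by apply/translationsS; exists i, c1.
  by rewrite exprS; ring.
case=> c1 [c2 [/translationsS[i [c' [ii h1 ->]]] h2 ->]].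
apply/translationsS; exists i, (c' + r ^+ n * c2); split => //.
  by apply/IHn; exists c', c2.
by rewrite exprS; ring.
Qed.

Lemma translations_prefix w w' n :
  (forall i, (i < n)%N -> w i = w' i) -> translations w n = translations w' n.
Proof.
rewrite /translations.
move=> ww'; suff [<- wm] : words S w n = words S w' n /\
    {in words S w n, forall s, word_map S w s 0 = word_map S w' s 0}.
  exact/eq_in_map.
elim: n w w' ww' => [|n IHn] w w' ww'; first by split=> // s /[!inE]/eqP ->.
have [|ws wm] := IHn (shift_seq w) (shift_seq w'); first by move=> i; exact: (ww' i.+1).
split=> [|s /wordsS[i [t [_ tt ->]]] /=]; first by rewrite /= (ww' 0%N)// ws.
by rewrite (ww' 0%N)// wm.
Qed.

Lemma rifs_imageE w n :
  rifs_image S w n [set 0] = [set c | c \in translations w n].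
Proof.
elim: n w => [|n IHn] w.
  by apply/seteqP; split=> x /=; rewrite inE => /eqP.
apply/seteqP; split=> x /=.
  case=> i /= ii [y]; rewrite -/rifs_image IHn => /= hy <-.
  by apply/translationsS; exists i, y.
case/translationsS => i [c [ii hc ->]]; exists i => //=; exists c => //.
by rewrite IHn.
Qed.

End Translations.

(** * Self-similarity and hull of the attractors *)

Section Attractor.
Context {R : realType} {m : nat} (S : equicontractive_rifs R m).
Context (hullS : full_hull S).
Local Notation r := (rifs_ratio S).
Implicit Types (w : nat -> 'I_m) (n k : nat).

Let r_gt0 : 0 < r := rifs_ratio_gt0 S.
Let r_lt1 : r < 1 := rifs_ratio_lt1 S.

Lemma edist_inf_lt_dist (A : set R) (x e : R) :
  (edist_inf A x < e%:E)%E -> exists2 y, A y & `|x - y| < e.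
Proof.
case/ereal_inf_lt => _ [y Ay <-] /edist_lt_ball /=.
by rewrite /ball /= => h; exists y.
Qed.

(** If no Hausdorff limit existed, [attractor] would be empty and so would be
    its hull. *)
Lemma attractor_is_attractor w : is_attractor S w (attractor S w).
Proof.
apply: (@xgetPex _ set0 [set K | is_attractor S w K]).
apply/not_existsP => no.
have K0 : attractor S w = set0 by apply: xgetPN => K; exact: no.
have : `[0, 1]%classic `<=` (set0 : set R).
  by rewrite -(hullS w) K0; apply: smallest_sub => // x y t; rewrite inE.
by move=> /(_ 0); apply; rewrite /= in_itv /= lexx ler01.
Qed.

Lemma hausdorff_dist_translations w (e : R) : 0 < e ->
  exists N, forall n, (N <= n)%N ->
   (hausdorff_dist [set c | c \in translations S w n] (attractor S w) < e%:E)%E.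
Proof.
move=> e0; have [_ _ /(_ [set 0] (@compact_set1 _ 0)) lim] := attractor_is_attractor w.
have {}lim := lim (ex_intro _ 0 erefl).
pose u n := hausdorff_dist (rifs_image S w n [set 0]) (attractor S w).
have : \forall n \near \oo, (u n < e%:E)%E.
  apply: (lim [set y | y < e%:E]%E); apply: open_nbhs_nbhs; split.
    exact: open_ereal_lt_ereal.
  by rewrite /= lte_fin.
case=> N _ HN; exists N => n Nn; rewrite -rifs_imageE; exact: HN.
Qed.

(** The sets of translations are the images of {0}, so they converge to the
    attractor; this and the next lemma turn that convergence into a description
    of the points of the attractor. *)
Lemma attractor_near_translations w x (e : R) : attractor S w x -> 0 < e ->
  exists N, forall n, (N <= n)%N -> exists2 c, c \in translations S w n & `|x - c| < e.
Proof.
move=> Kx e0; have [N HN] := hausdorff_dist_translations w e0.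
exists N => n /HN; rewrite /hausdorff_dist gt_max => /andP[_ lt].
apply: edist_inf_lt_dist; apply: le_lt_trans lt.
by apply: ereal_sup_ubound; exists x.
Qed.

(** The attractor is closed, and translations of high level are close to it. *)
Lemma limit_translations_attractor w x :
  (forall e, 0 < e -> forall N, exists n, (N <= n)%N /\
     exists2 c, c \in translations S w n & `|x - c| < e) ->
  attractor S w x.
Proof.
move=> H; have [cK _ _] := attractor_is_attractor w.
have clK : closed (attractor S w) by apply: compact_closed => //; exact: Rhausdorff.
apply: clK => B /nbhs_ballP[e /= e0 sub].
have e20 : 0 < e / 2 by rewrite divr_gt0.
have [N HN] := hausdorff_dist_translations w e20.
have [n [Nn [c hc xc]]] := H _ e20 N.
move: (HN n Nn); rewrite /hausdorff_dist gt_max => /andP[lt _].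
have [|y Ky cy] := @edist_inf_lt_dist (attractor S w) c (e / 2).
  by apply: le_lt_trans lt; apply: ereal_sup_ubound; exists c.
exists y; split => //; apply: sub; rewrite /ball /=.
rewrite (splitr e) (_ : x - y = (x - c) + (c - y)); last by ring.
by rewrite (le_lt_trans (ler_normD _ _))// ltrD.
Qed.

(** A point of the attractor is a limit of translations; infinitely many of
    these start with the same letter, and removing it gives a sequence
    converging to a point of the attractor of the shifted sequence. *)
Lemma attractorS w x :
  attractor S w x <->
  exists i y, [/\ (i <= maxidx S (w 0%N))%N, attractor S (tail 1 w) y &
                  x = r * y + trans S (w 0%N) i].
Proof.
split; last first.
  case=> i [y [ii Ky ->]]; apply: limit_translations_attractor => e e0 N.
  have [N1 /(_ (maxn N1 N) (leq_maxl _ _)) [c hc yc]] := attractor_near_translations Ky e0.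
  exists (maxn N1 N).+1; split; first by rewrite ltnW// ltnS leq_maxr.
  exists (r * c + trans S (w 0%N) i); first by apply/translationsS; exists i, c.
  rewrite (_ : _ - _ = r * (y - c)); last by ring.
  rewrite normrM gtr0_norm// (le_lt_trans _ yc)// ler_piMl// ltW//.
move=> Kx; apply: contrapT => no.
(* For each first index i, a distance eN.1 that the preimage of x keeps from all
   translations of level at least eN.2. *)
have far i : exists eN : R * nat, (i <= maxidx S (w 0%N))%N -> 0 < eN.1 /\
    forall n, (eN.2 <= n)%N -> forall c, c \in translations S (tail 1 w) n ->
    eN.1 <= `|(x - trans S (w 0%N) i) / r - c|.
  case: (leqP i (maxidx S (w 0%N))) => [ii|_]; last by exists (0, 0%N).
  apply: contrapT => Hno; apply: no.
  exists i, ((x - trans S (w 0%N) i) / r); split => //; last first.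
    by rewrite mulrC divfK ?subrK// gt_eqF.
  apply: limit_translations_attractor => e e0 N; apply: contrapT => Hno2.
  apply: Hno; exists (e, N) => _ /=; split=> // n Nn c hc.
  rewrite leNgt; apply/negP => lt; apply: Hno2; exists n; split=> //; by exists c.
have [f Hf] := choice far.
pose M := maxidx S (w 0%N).
have [e [e0 He]] : exists e, 0 < e /\ forall i, (i <= M)%N -> e <= (f i).1.
  have : forall i, (i <= M)%N -> 0 < (f i).1 by move=> i ii; case: (Hf i ii).
  elim: (M) => [|p IHp] pos.
    by exists (f 0%N).1; split; [exact: pos|move=> i; rewrite leqn0 => /eqP->].
  have [|e [e0 He]] := IHp; first by move=> i ip; apply: pos; exact: leqW.
  exists (Order.min e (f p.+1).1); split; first by rewrite lt_min e0 pos.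
  move=> i; rewrite leq_eqVlt => /orP[/eqP->|]; first by rewrite ge_min lexx orbT.
  by rewrite ltnS => /He h; rewrite ge_min h.
have re0 : 0 < r * e by rewrite mulr_gt0.
have [N HN] := attractor_near_translations Kx re0.
pose Nmax := \max_(i < M.+1) (f i).2.
have [c hc xc] := HN (maxn N Nmax).+1 (leqW (leq_maxl _ _)).
have [i [c' [ii hc' cE]]] := (iffLR (translationsS S w _ c)) hc.
have [_ /(_ (maxn N Nmax) _ c' hc')] := Hf i ii.
have -> : ((f i).2 <= maxn N Nmax)%N.
  by rewrite leq_max (leq_bigmax (Ordinal (ii : (i < M.+1)%N))) orbT.
move=> /(_ isT) le; have := le_trans (He _ ii) le; rewrite leNgt => /negP; apply.
rewrite -(ltr_pM2l r_gt0) -[X in X * `|_|](gtr0_norm r_gt0) -normrM.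
suff -> : r * ((x - trans S (w 0%N) i) / r - c') = x - c by [].
by rewrite cE; field; rewrite gt_eqF.
Qed.

Lemma attractor_cat w n x :
  attractor S w x <->
  exists c y, [/\ c \in translations S w n, attractor S (tail n w) y &
                  x = c + r ^+ n * y].
Proof.
elim: n w x => [|n IHn] w x.
  split=> [Kx|[c [y [/[!inE]/eqP-> Ky ->]]]].
    by exists 0, x; rewrite inE eqxx expr0 mul1r add0r.
  by rewrite expr0 mul1r add0r.
split.
  case/attractorS => i [y [ii /IHn[c [z [hc Kz ->]]] ->]].
  exists (r * c + trans S (w 0%N) i), z; split; last 1 first.
  - by rewrite exprS; ring.
  - by apply/translationsS; exists i, c.
  - by move: Kz; rewrite tail_tail.
case=> c [y [/translationsS[i [c' [ii h1 ->]]] Ky ->]].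
apply/attractorS; exists i, (c' + r ^+ n * y); split => //; last by rewrite exprS; ring.
by apply/IHn; exists c', y; split=> //; rewrite tail_tail.
Qed.

Lemma attractor_bounds w x : attractor S w x -> 0 <= x <= 1.
Proof.
move=> Kx; have : smallest (@convex_set R R^o) (attractor S w) x.
  exact: (sub_smallest (@subset_refl _ _)).
by rewrite (hullS w) /= in_itv.
Qed.

(** Were 0 missing, the convex set of positive numbers would contain the
    attractor, hence its hull; similarly for 1. *)
Lemma attractor01 w : attractor S w 0 /\ attractor S w 1.
Proof.
have cvx (a : R) : forall A : set R, attractor S w `<=` A ->
    convex_set (A : set R^o) -> (a \in `[0, 1]) -> A a.
  move=> A KA cA a01; have : `[0, 1]%classic a by rewrite /= a01.
  by rewrite -(hullS w); move: a {a01}; exact: smallest_sub.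
split; apply: contrapT => nK.
- suff : [set x : R | 0 < x] 0 by rewrite /= ltxx.
  apply: cvx; last by rewrite in_itv /= lexx ler01.
    move=> x Kx /=; have /andP[x0 _] := attractor_bounds Kx.
    by rewrite lt_neqAle x0 andbT; apply/eqP => x0'; apply: nK; rewrite x0'.
  apply/convex_setW => x y; rewrite !inE /= => x0 y0 t t0 t1; apply/mem_set => /=.
  rewrite -[conv _ _ _]/(t%:num * x + (1 - t%:num) * y : R).
  by rewrite addr_gt0// mulr_gt0// subr_gt0.
- suff : [set x : R | x < 1] 1 by rewrite /= ltxx.
  apply: cvx; last by rewrite in_itv /= lexx ler01.
    move=> x Kx /=; have /andP[_ x1] := attractor_bounds Kx.
    by rewrite lt_neqAle x1 andbT; apply/eqP => x1'; apply: nK; rewrite -x1'.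
  apply/convex_setW => x y; rewrite !inE /= => x1 y1 t t0 t1; apply/mem_set => /=.
  rewrite -[conv _ _ _]/(t%:num * x + (1 - t%:num) * y : R).
  move: (t%:num) t0 t1 => u; nra.
Qed.

End Attractor.

(** * Consecutive elements of a sorted sequence *)

Section Sequences.
Context {R : realType}.
Implicit Types (h : seq R) (D : R * R).

Lemma seq_has_max h (p : pred R) : has p h ->
  exists l, [/\ l \in h, p l & forall e, e \in h -> p e -> e <= l].
Proof.
elim: h => //= a h IHh; case: (boolP (has p h)) => [/IHh[l [lh pl ub]] _|/hasPn nh].
  case: (boolP (p a && (l < a))) => [/andP[pa la]|nla].
    exists a; split; rewrite ?mem_head// => e; rewrite inE => /orP[/eqP->//|eh pe].
    exact: le_trans (ub _ eh pe) (ltW la).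
  exists l; split=> //; first by rewrite inE lh orbT.
  move=> e; rewrite inE => /orP[/eqP-> pa|]; last exact: ub.
  by move: nla; rewrite pa /= -leNgt.
rewrite orbF => pa; exists a; split; rewrite ?mem_head// => e.
by rewrite inE => /orP[/eqP->//|/nh /negP].
Qed.

Lemma seq_has_min h (p : pred R) : has p h ->
  exists l, [/\ l \in h, p l & forall e, e \in h -> p e -> l <= e].
Proof.
move=> /hasP[a ah pa]; have [|l [/mapP[l' l'h ->] pl ub]] :=
  @seq_has_max [seq - x | x <- h] (fun x => p (- x)).
  by apply/hasP; exists (- a); rewrite ?opprK// map_f.
exists l'; rewrite opprK in pl; split=> // e eh pe.
by rewrite -lerN2 ub ?opprK// map_f.
Qed.

(** The pairs used to form net intervals are the gaps of the sequence. *)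
Lemma mem_consecutive h D : sorted <%R h ->
  (D \in zip h (behead h)) <->
  [/\ D.1 \in h, D.2 \in h, D.1 < D.2 &
      forall e, e \in h -> D.1 < e -> D.2 <= e].
Proof.
elim: h => [|a [|b h] IHh] hs //=.
- by split=> // -[].
- by split=> // -[/[!inE]/eqP-> /eqP->]; rewrite ltxx.
have /andP[ab bh] : (a < b) && path <%R b h := hs.
have min e : e \in h -> b < e.
  by move=> eh; have /allP := order_path_min lt_trans bh; apply.
rewrite inE; split.
  case/orP => [/eqP->/=|].
    rewrite !inE !eqxx orbT; split=> // e; rewrite !inE.
    by case/or3P => [/eqP->|/eqP->//|/min/ltW//]; rewrite ltxx.
  move/(IHh bh) => [D1 D2 DD gap]; split=> //.
  - by rewrite inE D1 orbT.
  - by rewrite inE D2 orbT.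
  - move=> e; rewrite inE => /orP[/eqP->|]; last exact: gap.
    move=> D1a; suff : b <= D.1 by lra.
    by move: D1; rewrite inE => /orP[/eqP->//|/min/ltW].
case=> D1 D2 DD gap; move: D1; rewrite inE => /orP[/eqP D1|D1].
  have := gap b; rewrite D1 !inE eqxx orbT => /(_ isT ab) D2b.
  have D2b' : D.2 = b.
    move: D2; rewrite !inE D1 in DD * => /or3P[/eqP D2|/eqP//|/min D2]; lra.
  by rewrite {1}(surjective_pairing D) D1 D2b' eqxx.
apply/orP; right; apply/(IHh bh); split=> //.
  move: D2; rewrite inE => /orP[/eqP D2|//].
  suff : b <= D.1 by lra.
  by move: D1; rewrite inE => /orP[/eqP->//|/min/ltW].
by move=> e eh; apply: gap; rewrite inE eh orbT.
Qed.

Lemma sorted_consecutive h : sorted <%R h ->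
  sorted (fun D D' => D.1 < D'.1) (zip h (behead h)).
Proof.
move=> hs; have : sorted <%R (unzip1 (zip h (behead h))).
  case: h hs => // a h; rewrite {1}lastI -cats1 => /cat_sorted2[hs _].
  suff zE : unzip1 (zip (a :: h) h) = belast a h by rewrite zE.
  by elim: h a {hs} => //= b h IHh a; rewrite -IHh.
by rewrite /unzip1 sorted_map.
Qed.

End Sequences.

(** * Gaps between consecutive endpoints *)

Section Cells.
Context {R : realType} {m : nat} (S : equicontractive_rifs R m).
Context (hullS : full_hull S).
Local Notation r := (rifs_ratio S).
Implicit Types (w : nat -> 'I_m) (n k : nat) (D P : R * R).

Let rn_gt0 n : 0 < r ^+ n := ratio_expn_gt0 S n.

Lemma attractor_copy w n c y :
  c \in translations S w n -> attractor S (tail n w) y -> attractor S w (c + r ^+ n * y).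
Proof. by move=> hc Ky; apply/(attractor_cat hullS w n); exists c, y. Qed.

Lemma translations_bounds w n c :
  c \in translations S w n -> 0 <= c /\ c + r ^+ n <= 1.
Proof.
move=> hc; have [K0 K1] := attractor01 hullS (tail n w).
have := attractor_bounds hullS (attractor_copy hc K0).
have := attractor_bounds hullS (attractor_copy hc K1).
by rewrite mulr1 mulr0 addr0 => /andP[_ ->] /andP[-> _].
Qed.

(** The attractor contains 0, and all copies lie in [0, 1], so the copy that
    contains 0 starts there. *)
Lemma translations_first w n : 0 \in translations S w n.
Proof.
have [/(attractor_cat hullS w n)[c [y [hc Ky E]]] _] := attractor01 hullS w.
have [c0 _] := translations_bounds hc; have /andP[y0 _] := attractor_bounds hullS Ky.
have ry : 0 <= r ^+ n * y by rewrite mulr_ge0// ltW.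
by rewrite (_ : 0 = c)//; lra.
Qed.

Lemma translations_last w n : 1 - r ^+ n \in translations S w n.
Proof.
have [_ /(attractor_cat hullS w n)[c [y [hc Ky E]]]] := attractor01 hullS w.
have [_ c1] := translations_bounds hc; have /andP[_ y1] := attractor_bounds hullS Ky.
have ry : r ^+ n * y <= r ^+ n by rewrite ger_pMr.
by rewrite (_ : 1 - _ = c)//; lra.
Qed.

(** The right end point 1 of a very deep first copy inside c + r^n [0, 1]. In
    particular no gap next to an endpoint of a copy, on the side of that copy,
    avoids the attractor. *)
Lemma attractor_right w n c e : c \in translations S w n -> 0 < e ->
  exists y, attractor S w y /\ c < y < c + e.
Proof.
move=> hc e0; have [k rk] := ratio_expn_small S e0.
have [_ K1] := attractor01 hullS (tail (n + k) w).
have hc' : c \in translations S w (n + k).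
  apply/translations_cat; exists c, 0; split; rewrite ?mulr0 ?addr0//.
  exact: translations_first.
exists (c + r ^+ (n + k)); split.
  by rewrite -[r ^+ _]mulr1; exact: attractor_copy.
have := rn_gt0 (n + k); suff : r ^+ (n + k) <= r ^+ k by lra.
by rewrite ler_wiXn2l ?leq_addl// ltW// (rifs_ratio_gt0, rifs_ratio_lt1).
Qed.

Lemma attractor_left w n c e : c \in translations S w n -> 0 < e ->
  exists y, attractor S w y /\ c + r ^+ n - e < y < c + r ^+ n.
Proof.
move=> hc e0; have [k rk] := ratio_expn_small S e0.
have [K0 _] := attractor01 hullS (tail (n + k) w).
have hc' : c + r ^+ n * (1 - r ^+ k) \in translations S w (n + k).
  apply/translations_cat; exists c, (1 - r ^+ k); split=> //; exact: translations_last.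
exists (c + r ^+ n * (1 - r ^+ k)); split.
  by have := attractor_copy hc' K0; rewrite mulr0 addr0.
have := rn_gt0 (n + k); rewrite mulrBr mulr1 -exprD.
suff : r ^+ (n + k) <= r ^+ k by lra.
by rewrite ler_wiXn2l ?leq_addl// ltW// (rifs_ratio_gt0, rifs_ratio_lt1).
Qed.

Lemma endpointsP w n e :
  (e \in endpoints S w n) <->
  exists2 c, c \in translations S w n & e = c \/ e = c + r ^+ n.
Proof.
rewrite /endpoints mem_sort mem_undup; split.
  move/allpairsPdep => [s [z [hs /[!inE] hz ->]]].
  exists (word_map S w s 0); first exact: map_f.
  rewrite (word_mapE _ hs); case/orP: hz => /eqP ->; first by left; rewrite mulr0 add0r.
  by right; rewrite mulr1 addrC.
case=> c /mapP[s hs ->] he; apply/allpairsPdep.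
case: he => ->; first by exists s, 0; rewrite !inE eqxx.
exists s, 1; rewrite !inE eqxx orbT; split=> //.
by rewrite (word_mapE 1 hs) mulr1 addrC.
Qed.

Lemma sorted_endpoints w n : sorted <%R (endpoints S w n).
Proof. by rewrite /endpoints sort_lt_sorted undup_uniq. Qed.

(** The first and last copy of each level touch 0 and 1, so they keep the
    endpoints of their ancestor. *)
Lemma endpoints_refine w n k e :
  e \in endpoints S w n -> e \in endpoints S w (n + k).
Proof.
case/endpointsP => c hc [->|->]; apply/endpointsP.
  exists c; last by left.
  apply/translations_cat; exists c, 0; split; rewrite ?mulr0 ?addr0//.
  exact: translations_first.
exists (c + r ^+ n * (1 - r ^+ k)).
  apply/translations_cat; exists c, (1 - r ^+ k); split=> //; exact: translations_last.
by right; rewrite exprD; ring.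
Qed.

Lemma endpoints01 w n : 0 \in endpoints S w n /\ 1 \in endpoints S w n.
Proof.
split; apply/endpointsP; first by exists 0; [exact: translations_first|left].
by exists (1 - r ^+ n); [exact: translations_last|right; rewrite subrK].
Qed.

Lemma endpoints_bounds w n e : e \in endpoints S w n -> 0 <= e <= 1.
Proof.
by case/endpointsP => c /translations_bounds[c0 c1] [->|->]; have := rn_gt0 n; lra.
Qed.

(** A candidate for a net interval. It depends on the first n letters only,
    whereas meeting the attractor involves the tail. *)
Definition cell w n D : Prop :=
  [/\ D.1 \in endpoints S w n, D.2 \in endpoints S w n, D.1 < D.2 &
      forall e, e \in endpoints S w n -> D.1 < e -> D.2 <= e].

Definition meets_attractor w D : Prop := exists2 x, attractor S w x & D.1 < x < D.2.

(** Level 0 is no exception, because (0, 1) always meets the attractor. *)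
Lemma net_intervalsP w n D :
  D \in net_intervals S w n <-> cell w n D /\ meets_attractor w D.
Proof.
have meetE : `]D.1, D.2[%classic `&` attractor S w !=set0 <-> meets_attractor w D.
  split=> [[x /= []]|[x Kx hx]]; first by rewrite in_itv /= => ? ?; exists x.
  by exists x; split=> //=; rewrite in_itv.
case: n => [|n]; last first.
  rewrite /net_intervals mem_filter; split.
    by case/andP => /asboolP/meetE ? /(mem_consecutive _ (sorted_endpoints _ _)).
  case=> ? ?; apply/andP; split; first exact/asboolP/meetE.
  exact/(mem_consecutive _ (sorted_endpoints _ _)).
rewrite inE; split=> [/eqP->|[[/= D1 D2 DD _] _]].
  split; first split=> //=; rewrite ?ltr01//; try by case: (endpoints01 w 0).
    move=> e /endpointsP[c /[!inE]/eqP-> [->|->]]; first by rewrite ltxx.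
    by rewrite add0r expr0.
  have [|y [Ky hy]] := @attractor_right w 0 0 1 _ ltr01; first by rewrite inE.
  by exists y => //=; lra.
move: D1 D2 => /endpointsP[c /[!inE]/eqP-> +] /endpointsP[d /[!inE]/eqP-> +].
rewrite !add0r expr0; case: D DD {meetE} => a b /= ab.
by move=> [D1|D1] [D2|D2]; rewrite D1 D2 ?eqxx//; move: ab; rewrite D1 D2; lra.
Qed.

Lemma sorted_net_intervals w n :
  sorted (fun D D' => D.1 < D'.1) (net_intervals S w n).
Proof.
case: n => // n; apply: sorted_filter; first by move=> ? ? ?; exact: lt_trans.
exact: sorted_consecutive (sorted_endpoints _ _).
Qed.

Lemma subitv_bounds D P : D.1 <= D.2 -> Defs.subitv D P = (P.1 <= D.1) && (D.2 <= P.2).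
Proof.
move=> DD; apply/asboolP/andP => [sub|[h1 h2] x /=].
  have := sub D.1; have := sub D.2; rewrite /= !in_itv /= !lexx DD.
  by move=> /(_ isT)/andP[_ ->] /(_ isT)/andP[-> _].
by rewrite !in_itv /= => /andP[? ?]; apply/andP; split; lra.
Qed.

Lemma neighbour_setP w n D v : D.1 <= D.2 ->
  v \in neighbour_set S w n D <->
  exists2 c, c \in translations S w n &
    [/\ v = r ^- n * (D.1 - c), c <= D.1 & D.2 <= c + r ^+ n].
Proof.
move=> DD; rewrite /neighbour_set mem_sort mem_undup.
have cover s : s \in words S w n ->
   `[D.1, D.2]%classic `<=` word_map S w s @` `[0, 1]%classic <->
   word_map S w s 0 <= D.1 /\ D.2 <= word_map S w s 0 + r ^+ n.
  move=> hs; split=> [sub|[h1 h2] x /=].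
    have img x : x \in `[D.1, D.2] ->
        word_map S w s 0 <= x <= word_map S w s 0 + r ^+ n.
      move/sub => [y /=]; rewrite in_itv /= (word_mapE _ hs) => /andP[y0 y1] <-.
      by have := rn_gt0 n; nra.
    have := img D.1; have := img D.2; rewrite !in_itv /= !lexx DD.
    by move=> /(_ isT)/andP[_ ->] /(_ isT)/andP[-> _].
  rewrite in_itv /= => /andP[x1 x2]; exists (r ^- n * (x - word_map S w s 0)).
    have q : 0 < r ^- n by rewrite invr_gt0.
    rewrite /= in_itv /= pmulr_rge0// mulrC ler_pdivrMr//.
    by apply/andP; split; lra.
  by rewrite (word_mapE _ hs) mulVKf ?subrK// gt_eqF.
split.
  case/mapP => s; rewrite mem_filter => /andP[/asboolP + hs] -> => /(cover _ hs)[h1 h2].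
  by exists (word_map S w s 0); [exact: map_f|].
case=> c /mapP[s hs ->] [-> h1 h2]; apply/mapP; exists s => //.
by rewrite mem_filter hs andbT; apply/asboolP/cover.
Qed.

Lemma sorted_neighbour_set w n D : sorted <%R (neighbour_set S w n D).
Proof. by rewrite /neighbour_set sort_lt_sorted undup_uniq. Qed.

(** Endpoints of level n remain endpoints at level n + k, so none cuts D. *)
Lemma cell_nested w n k P D : cell w n P -> cell w (n + k) D ->
  D.1 < P.2 -> P.1 < D.2 -> P.1 <= D.1 /\ D.2 <= P.2.
Proof.
move=> [P1 P2 _ _] [_ _ _ gap] h1 h2; split; last by rewrite gap// endpoints_refine.
by rewrite leNgt; apply/negP => lt; have := gap P.1 (endpoints_refine k P1) lt; lra.
Qed.

Lemma cell_unique w n P D : cell w n P -> cell w n D ->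
  D.1 < P.2 -> P.1 < D.2 -> P = D.
Proof.
rewrite -{2}(addn0 n) => cP cD h1 h2; have [a b] := cell_nested cP cD h1 h2.
rewrite addn0 in cD; rewrite -(addn0 n) in cP.
have [c d] := cell_nested cD cP h2 h1.
by rewrite (surjective_pairing P) (surjective_pairing D); congr pair; lra.
Qed.

(** A copy that overlaps P has no endpoint inside P: it is a neighbour of P. *)
Lemma cell_covered w n P c : cell w n P -> c \in translations S w n ->
  c < P.2 -> P.1 < c + r ^+ n -> c <= P.1 /\ P.2 <= c + r ^+ n.
Proof.
move=> [_ _ _ gap] hc h1 h2; split; last first.
  by apply: gap => //; apply/endpointsP; exists c => //; right.
rewrite leNgt; apply/negP => lt.
by have := gap c (iffRL (endpointsP w n c) (ex_intro2 _ _ c hc (or_introl erefl))) lt; lra.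
Qed.

Lemma cell_exists w n x : 0 <= x <= 1 -> x \notin endpoints S w n ->
  exists2 P, cell w n P & P.1 < x < P.2.
Proof.
move=> /andP[x0 x1] xE; have [E0 E1] := endpoints01 w n.
have ne e : e \in endpoints S w n -> e != x by move=> eE; apply: contraNneq xE => <-.
have [|a [aE ax amax]] := @seq_has_max _ (endpoints S w n) (fun e => e < x).
  by apply/hasP; exists 0; rewrite // lt_neqAle x0 ne.
have [|b [bE xb bmin]] := @seq_has_min _ (endpoints S w n) (fun e => x < e).
  by apply/hasP; exists 1; rewrite // lt_neqAle x1 eq_sym ne.
exists (a, b) => /=; last by rewrite ax xb.
split=> //=; first exact: lt_trans xb.
move=> e eE ae; apply: bmin => //; rewrite lt_neqAle eq_sym ne//= leNgt.
by apply/negP => /(amax _ eE); lra.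
Qed.

(** A point of the attractor in D may be an endpoint of level n and thus in no
    gap; but then it is an end of a copy, and [attractor_right] or
    [attractor_left] gives points of the attractor nearby that are not
    endpoints. *)
Lemma net_interval_meeting w n D : meets_attractor w D ->
  exists2 P, P \in net_intervals S w n & P.1 < D.2 /\ D.1 < P.2.
Proof.
move=> [x Kx hx].
suff [y Ky [yE hy]] : exists2 y, attractor S w y &
    y \notin endpoints S w n /\ D.1 < y < D.2.
  have [P cP hP] := cell_exists (attractor_bounds hullS Ky) yE.
  exists P; last by split; lra.
  by apply/net_intervalsP; split=> //; exists y.
case: (boolP (x \in endpoints S w n)) => [/endpointsP[c hc xc]|xE]; last by exists x.
(* The other endpoints stay at a positive distance e from x. *)
have [e e0 far] : exists2 e, 0 < e & forall z, z \in endpoints S w n -> z != x -> e <= `|z - x|.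
  case: (boolP (has (fun z => z != x) (endpoints S w n))) => [hz|/hasPn no].
    have [|_ [/mapP[z zE ->] /= zx zmin]] :=
       @seq_has_min _ [seq `|z - x| | z <- endpoints S w n] (fun t => 0 < t).
      move: hz => /hasP[z zE zx]; apply/hasP; exists `|z - x|; first exact: map_f.
      by rewrite normr_gt0 subr_eq0.
    exists `|z - x| => // u uE ux; apply: zmin; first by apply/mapP; exists u.
    by rewrite normr_gt0 subr_eq0.
  by exists 1 => // z /no /negPn ->.
have notE y : y != x -> `|y - x| < e -> y \notin endpoints S w n.
  by move=> yx ye; apply/negP => yE; have := far _ yE yx; lra.
case: xc => xc.
  have [|y [Ky hy]] := @attractor_right w n c (Order.min e (D.2 - x)) hc.
    by rewrite lt_min e0; lra.
  have [me mD] : Order.min e (D.2 - x) <= e /\ Order.min e (D.2 - x) <= D.2 - x.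
    by rewrite !ge_min !lexx orbT.
  exists y => //; split; last by lra.
  apply: notE; first by rewrite gt_eqF//; lra.
  by rewrite ger0_norm; lra.
have [|y [Ky hy]] := @attractor_left w n c (Order.min e (x - D.1)) hc.
  by rewrite lt_min e0; lra.
have [me mD] : Order.min e (x - D.1) <= e /\ Order.min e (x - D.1) <= x - D.1.
  by rewrite !ge_min !lexx orbT.
exists y => //; split; last by lra.
apply: notE; first by rewrite lt_eqF//; lra.
by rewrite ltr0_norm; lra.
Qed.

Lemma net_interval_child w n P : P \in net_intervals S w n ->
  exists2 D, D \in net_intervals S w n.+1 & P.1 <= D.1 /\ D.2 <= P.2.
Proof.
case/net_intervalsP => cP /(net_interval_meeting n.+1)[D hD [D1 D2]]; exists D => //.
have [cD _] := iffLR (net_intervalsP _ _ _) hD.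
by rewrite -addn1 in cD; apply: (cell_nested cP cD).
Qed.

Lemma net_interval_ancestor w n k D : D \in net_intervals S w (n + k) ->
  exists2 P, P \in net_intervals S w n & P.1 <= D.1 /\ D.2 <= P.2.
Proof.
case/net_intervalsP => cD [x Kx hx].
have [|P cP hP] := @cell_exists w n x (attractor_bounds hullS Kx).
  apply/negP => /(endpoints_refine k) xE; have [_ _ _ gap] := cD.
  by have := gap x xE; lra.
exists P; first by apply/net_intervalsP; split=> //; exists x.
by apply: (cell_nested cP cD); lra.
Qed.

Lemma cell_prefix w w' n D : (forall i, (i < n)%N -> w i = w' i) ->
  cell w n D -> cell w' n D.
Proof.
move=> ww'; suff EE : endpoints S w n =i endpoints S w' n.
  by case=> h1 h2 h3 h4; split=> // [||e]; rewrite -EE//; exact: h4.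
move=> e; apply/idP/idP => /endpointsP[c hc ec]; apply/endpointsP; exists c => //;
 by move: hc; rewrite (translations_prefix S ww').
Qed.

Lemma neighbour_set_prefix w w' n D : D.1 <= D.2 -> (forall i, (i < n)%N -> w i = w' i) ->
  neighbour_set S w n D = neighbour_set S w' n D.
Proof.
move=> DD ww'; apply: lt_sorted_eq; rewrite ?sorted_neighbour_set// => v.
apply/idP/idP => /(neighbour_setP _ _ _ DD)[c hc vc]; apply/(neighbour_setP _ _ _ DD);
  by exists c => //; move: hc; rewrite (translations_prefix S ww').
Qed.

End Cells.

(** * Intervals with the same length, neighbours and tail *)

Section Similarity.
Context {R : realType} {m : nat} (S : equicontractive_rifs R m).
Context (hullS : full_hull S).
Local Notation r := (rifs_ratio S).
Local Notation cell := (cell S).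
Implicit Types (w : nat -> 'I_m) (n k : nat) (D P : R * R).

Let rn_gt0 n : 0 < r ^+ n := ratio_expn_gt0 S n.

(** The increasing affine map of P onto P'. *)
Definition rescale P P' (x : R) : R :=
  P'.1 + (P'.2 - P'.1) / (P.2 - P.1) * (x - P.1).

Definition rescale_itv P P' D : R * R := (rescale P P' D.1, rescale P P' D.2).

Lemma rescaleK P P' : P.1 < P.2 -> P'.1 < P'.2 ->
  cancel (rescale P P') (rescale P' P).
Proof.
by move=> lt lt' x; rewrite /rescale; field; apply/andP; split; rewrite subr_eq0 gt_eqF.
Qed.

Lemma rescale_itvK P P' : P.1 < P.2 -> P'.1 < P'.2 ->
  cancel (rescale_itv P P') (rescale_itv P' P).
Proof. by move=> lt lt' D; rewrite /rescale_itv /= !rescaleK//; case: D. Qed.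

Lemma ltr_rescale P P' : P.1 < P.2 -> P'.1 < P'.2 ->
  {mono rescale P P' : x y / x < y}.
Proof.
move=> lt lt' x y; rewrite /rescale ltrD2l ltr_pM2l ?divr_gt0 ?subr_gt0//.
by rewrite ltrD2r.
Qed.

Lemma ler_rescale P P' : P.1 < P.2 -> P'.1 < P'.2 ->
  {mono rescale P P' : x y / x <= y}.
Proof. by move=> lt lt' x y; rewrite !leNgt ltr_rescale. Qed.

Lemma rescale_left P P' : rescale P P' P.1 = P'.1.
Proof. by rewrite /rescale subrr mulr0 addr0. Qed.

Lemma rescale_right P P' : P.1 < P.2 -> rescale P P' P.2 = P'.2.
Proof. by move=> lt; rewrite /rescale; field; rewrite subr_eq0 gt_eqF. Qed.

Lemma rescale_itv_self P P' : P.1 < P.2 -> rescale_itv P P' P = P'.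
Proof. by move=> lt; rewrite /rescale_itv rescale_left rescale_right//; case: P'. Qed.

(** The data that determine everything inside P from level n on; the attractor
    enters through the tail only. *)
Definition similar_cells w n P w' n' P' : Prop :=
  [/\ cell w n P, cell w' n' P', norm_length S n P = norm_length S n' P',
      neighbour_set S w n P = neighbour_set S w' n' P' & tail n w = tail n' w'].

Lemma similar_sym w n P w' n' P' : similar_cells w n P w' n' P' -> similar_cells w' n' P' w n P.
Proof. by case. Qed.

Lemma cell_lt w n P : cell w n P -> P.1 < P.2.
Proof. by case. Qed.

Section Transfer.
Context (w : nat -> 'I_m) (n : nat) (P : R * R).
Context (w' : nat -> 'I_m) (n' : nat) (P' : R * R).
Context (sim : similar_cells w n P w' n' P').
Local Notation phi := (rescale P P').

(** Equality of the normalized lengths makes r^n' / r^n the slope of the affine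
    map. *)
Lemma similar_affine x y : phi (x + r ^+ n * y) = phi x + r ^+ n' * y.
Proof.
have [/cell_lt lt _ eq _ _] := sim.
have -> : r ^+ n' = (P'.2 - P'.1) / (P.2 - P.1) * r ^+ n.
  move: eq; rewrite /norm_length => /(congr1 ( *%R (r ^+ n'))).
  rewrite mulVKf ?gt_eqF// => <-.
  by field; rewrite subr_eq0 !gt_eqF.
by rewrite /rescale; ring.
Qed.

(** The copy at c covers P, so it gives a neighbour of P, hence one of P', whose
    copy sits at the image of c. *)
Lemma similar_translation c : c \in translations S w n ->
  c < P.2 -> P.1 < c + r ^+ n -> phi c \in translations S w' n'.
Proof.
move=> hc c1 c2; have [cP cP' eq eqV _] := sim.
have [cP1 cP2] := cell_covered cP hc c1 c2.
have : r ^- n * (P.1 - c) \in neighbour_set S w n P.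
  by apply/neighbour_setP; [exact/ltW/(cell_lt cP)|exists c].
rewrite eqV => /neighbour_setP -/(_ (ltW (cell_lt cP')))[c' hc' [E _ _]].
suff -> : phi c = c' by [].
have -> : c = P.1 + r ^+ n * - (r ^- n * (P.1 - c)).
  by rewrite mulrN mulVKf ?gt_eqF//; ring.
rewrite similar_affine rescale_left E mulrN mulVKf ?gt_eqF//; ring.
Qed.

Lemma similar_translation_refined k c : c \in translations S w (n + k) ->
  c < P.2 -> P.1 < c + r ^+ (n + k) -> phi c \in translations S w' (n' + k).
Proof.
case/translations_cat => c1 [c2 [h1 h2 ->]] lt1 lt2.
have [c20 c21] := translations_bounds hullS h2; rewrite exprD in lt2.
have := rn_gt0 n => rn.
have phi1 : phi c1 \in translations S w' n'.
  by apply: similar_translation => //; nra.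
rewrite similar_affine; apply/translations_cat; exists (phi c1), c2; split=> //.
by have [_ _ _ _ <-] := sim.
Qed.

(** An endpoint inside P belongs to a copy that overlaps P; the ends of P itself
    are endpoints at every deeper level. *)
Lemma similar_endpoint k e : e \in endpoints S w (n + k) -> P.1 <= e <= P.2 ->
  phi e \in endpoints S w' (n' + k).
Proof.
have [[P1 P2 lt _] [P1' P2' lt' _] _ _ _] := sim.
move=> eE /andP[]; rewrite le_eqVlt => /orP[/eqP<- _|Pe].
  by rewrite rescale_left (endpoints_refine hullS).
rewrite le_eqVlt => /orP[/eqP->|eP].
  by rewrite rescale_right// (endpoints_refine hullS).
have rnk := rn_gt0 (n + k).
case/endpointsP: eE => c hc [ec|ec]; apply/endpointsP; exists (phi c).
- by apply: similar_translation_refined => //; lra.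
- by left; rewrite ec.
- by apply: similar_translation_refined => //; lra.
- by right; rewrite ec exprD similar_affine -exprD.
Qed.

(** Points of the attractor inside P lie in level-n copies that overlap P, where
    the attractor of the common tail is seen. *)
Lemma similar_attractor x : attractor S w x -> P.1 < x < P.2 -> attractor S w' (phi x).
Proof.
case/(attractor_cat hullS w n) => c [y [hc Ky ->]] /andP[lt1 lt2].
have /andP[y0 y1] := attractor_bounds hullS Ky; have rn := rn_gt0 n.
rewrite similar_affine; apply: (attractor_copy hullS); last by have [_ _ _ _ <-] := sim.
by apply: similar_translation => //; nra.
Qed.

End Transfer.

Lemma similar_norm_length w n P w' n' P' k D : similar_cells w n P w' n' P' ->
  norm_length S (n' + k) (rescale_itv P P' D) = norm_length S (n + k) D.
Proof.
move=> sim; rewrite /norm_length /=.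
have -> : D.2 = D.1 + r ^+ n * (r ^- n * (D.2 - D.1)).
  by rewrite mulVKf ?gt_eqF//; ring.
rewrite (similar_affine sim) !exprD; field.
by rewrite !gt_eqF// rifs_ratio_gt0.
Qed.

(** The inverse map is of the same kind, so it would bring an endpoint inside
    the image of D back into D. *)
Lemma similar_cell w n P w' n' P' k D : similar_cells w n P w' n' P' ->
  cell w (n + k) D -> P.1 <= D.1 -> D.2 <= P.2 -> cell w' (n' + k) (rescale_itv P P' D).
Proof.
move=> sim [D1 D2 DD gap] le1 le2.
have [/cell_lt lt /cell_lt lt' _ _ _] := sim.
split=> /=.
- by apply: (similar_endpoint sim) => //; lra.
- by apply: (similar_endpoint sim) => //; lra.
- by rewrite ltr_rescale.
move=> e eE De; rewrite leNgt; apply/negP => eD.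
have := similar_endpoint (similar_sym sim) eE.
have phiD x : P.1 <= x <= P.2 -> P'.1 <= rescale P P' x <= P'.2.
  move=> /andP[h1 h2]; apply/andP; split.
    by rewrite -(rescale_left P P') ler_rescale.
  by rewrite -(rescale_right P' lt) ler_rescale.
have -> : P'.1 <= e <= P'.2.
  have /andP[? ?] : P'.1 <= rescale P P' D.1 <= P'.2 by apply: phiD; lra.
  have /andP[? ?] : P'.1 <= rescale P P' D.2 <= P'.2 by apply: phiD; lra.
  lra.
have De' : D.1 < rescale P' P e by rewrite -(ltr_rescale lt lt') (rescaleK lt' lt).
have eD' : rescale P' P e < D.2 by rewrite -(ltr_rescale lt lt') (rescaleK lt' lt).
by move=> /(_ isT)/gap/(_ De'); rewrite leNgt eD'.
Qed.

Lemma similar_net_interval w n P w' n' P' k D : similar_cells w n P w' n' P' ->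
  D \in net_intervals S w (n + k) -> P.1 <= D.1 -> D.2 <= P.2 ->
  rescale_itv P P' D \in net_intervals S w' (n' + k).
Proof.
move=> sim /(net_intervalsP hullS)[cD [x Kx xD]] le1 le2.
have [/cell_lt lt /cell_lt lt' _ _ _] := sim.
apply/(net_intervalsP hullS); split; first exact: (similar_cell sim).
exists (rescale P P' x); last by rewrite /= !ltr_rescale.
by apply: (similar_attractor sim) => //; lra.
Qed.

(** The case in which the deeper interval is P itself: meeting the attractor
    depends on the length, neighbour set and tail only. *)
Lemma similar_is_net_interval w n P w' n' P' : similar_cells w n P w' n' P' ->
  P \in net_intervals S w n -> P' \in net_intervals S w' n'.
Proof.
move=> sim; have [/cell_lt lt _ _ _ _] := sim.
rewrite -(addn0 n) -(addn0 n') => hP.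
by rewrite -[P'](rescale_itv_self P' lt); apply: (similar_net_interval sim).
Qed.

Lemma similar_neighbour_sub w n P w' n' P' k D v : similar_cells w n P w' n' P' ->
  D.1 < D.2 -> P.1 <= D.1 -> D.2 <= P.2 ->
  v \in neighbour_set S w (n + k) D ->
  v \in neighbour_set S w' (n' + k) (rescale_itv P P' D).
Proof.
move=> sim DD le1 le2; have [/cell_lt lt /cell_lt lt' _ _ _] := sim.
case/(neighbour_setP S _ _ _ (ltW DD)) => c hc [-> cD1 cD2].
apply/neighbour_setP; first by rewrite /= ler_rescale// ltW.
exists (rescale P P' c).
  by apply: (similar_translation_refined sim) => //; lra.
split=> /=; last 2 first.
- by rewrite ler_rescale.
- by rewrite exprD -(similar_affine sim) -exprD ler_rescale.
have -> : D.1 = c + r ^+ n * (r ^- n * (D.1 - c)).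
  by rewrite mulVKf ?gt_eqF//; ring.
rewrite (similar_affine sim) !exprD; field.
by rewrite !gt_eqF// rifs_ratio_gt0.
Qed.

Lemma similar_neighbour_set w n P w' n' P' k D : similar_cells w n P w' n' P' ->
  D.1 < D.2 -> P.1 <= D.1 -> D.2 <= P.2 ->
  neighbour_set S w' (n' + k) (rescale_itv P P' D) = neighbour_set S w (n + k) D.
Proof.
move=> sim DD le1 le2; have [/cell_lt lt /cell_lt lt' _ _ _] := sim.
apply: lt_sorted_eq; rewrite ?sorted_neighbour_set// => v; apply/idP/idP; last first.
  exact: (similar_neighbour_sub sim).
rewrite -{2}(rescale_itvK lt lt' D).
apply: (similar_neighbour_sub (similar_sym sim)) => /=.
- by rewrite ltr_rescale.
- by rewrite -(rescale_left P P') ler_rescale.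
- by rewrite -(rescale_right P' lt) ler_rescale.
Qed.

Lemma similar_sub w n P w' n' P' k D : similar_cells w n P w' n' P' ->
  cell w (n + k) D -> P.1 <= D.1 -> D.2 <= P.2 ->
  similar_cells w (n + k) D w' (n' + k) (rescale_itv P P' D).
Proof.
move=> sim cD le1 le2; split=> //.
- exact: (similar_cell sim).
- by rewrite (similar_norm_length _ _ sim).
- by rewrite (similar_neighbour_set _ sim)//; exact: cell_lt cD.
- by have [_ _ _ _ E] := sim; rewrite -!tail_tail E.
Qed.

End Similarity.

(** * Dependence of characteristic vectors on the sequence *)

Section CharacteristicVectors.
Context {R : realType} {m : nat} (S : equicontractive_rifs R m).
Context (hullS : full_hull S).
Local Notation cell := (cell S).
Local Notation similar_cells := (similar_cells S).
Implicit Types (w : nat -> 'I_m) (n k : nat) (D P : R * R).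

Lemma net_interval_cell w n D : D \in net_intervals S w n -> cell w n D.
Proof. by move/(net_intervalsP hullS) => []. Qed.

Lemma net_interval_lt w n D : D \in net_intervals S w n -> D.1 < D.2.
Proof. by move/net_interval_cell/cell_lt. Qed.

Lemma childrenP w n P D : D \in children S w n P <->
  [/\ D \in net_intervals S w n.+1, P.1 <= D.1 & D.2 <= P.2].
Proof.
rewrite /children mem_filter; split.
  by case/andP => + hD; rewrite (subitv_bounds _ (ltW (net_interval_lt hD))) => /andP[].
by case=> hD h1 h2; rewrite hD (subitv_bounds _ (ltW (net_interval_lt hD))) h1 h2.
Qed.

Lemma parent_eq w n P D : P \in net_intervals S w n -> D \in children S w n P ->
  parent S w n D = P.
Proof.
move=> hP /childrenP[hD h1 h2]; rewrite /parent.
have DD := net_interval_lt hD; have subE Q := subitv_bounds Q (ltW DD).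
set s := seq.filter _ _.
have sP Q : Q \in s -> Q = P.
  rewrite mem_filter subE => /andP[/andP[q1 q2] hQ].
  by apply: (cell_unique hullS (net_interval_cell hQ) (net_interval_cell hP)); lra.
have : P \in s by rewrite mem_filter hP subE h1 h2.
by case: (s) sP => // Q t sP _; apply: sP; rewrite mem_head.
Qed.

Lemma eq_sorted_itv (s t : seq (R * R)) :
  sorted (fun D D' => D.1 < D'.1) s -> sorted (fun D D' => D.1 < D'.1) t ->
  s =i t -> s = t.
Proof.
by apply: irr_sorted_eq => [? ? ?|?]; [exact: lt_trans|exact: ltxx].
Qed.

Lemma sorted_itv_filter (p : pred (R * R)) (s : seq (R * R)) :
  sorted (fun D D' => D.1 < D'.1) s ->
  sorted (fun D D' => D.1 < D'.1) [seq D <- s | p D].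
Proof. by apply: sorted_filter => ? ? ?; exact: lt_trans. Qed.

(** A smaller net interval for w' provides the point of the attractor of w'. *)
Lemma net_interval_prefix w w' n k P D : P \in net_intervals S w n ->
  (forall i, (i < n)%N -> w i = w' i) ->
  D \in net_intervals S w' (n + k) -> P.1 <= D.1 -> D.2 <= P.2 ->
  P \in net_intervals S w' n.
Proof.
move=> /net_interval_cell cP ww' /(net_intervalsP hullS)[_ [x Kx xD]] h1 h2.
apply/(net_intervalsP hullS); split; first exact: (cell_prefix ww').
by exists x => //; lra.
Qed.

(** For the same sequence w', D and D' see the same tail, so they are similar;
    as D meets the attractor of w', so does D'. *)
Lemma siblings_prefix w w' n D D' : (forall i, (i < n)%N -> w i = w' i) ->
  D \in net_intervals S w n -> D \in net_intervals S w' n ->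
  norm_length S n D' = norm_length S n D ->
  neighbour_set S w n D' = neighbour_set S w n D ->
  D' \in net_intervals S w n -> D' \in net_intervals S w' n.
Proof.
move=> ww' hD hD' eql eqV hE.
apply: (similar_is_net_interval hullS _ hD'); split=> //.
- exact: (net_interval_cell hD').
- exact: (cell_prefix ww' (net_interval_cell hE)).
- rewrite -(neighbour_set_prefix _ _ ww') ?ltW ?(net_interval_lt hD)//.
  by rewrite -(neighbour_set_prefix _ _ ww') ?ltW ?(net_interval_lt hE).
Qed.

(** Length and neighbour set clearly do not see the tail; the position does not
    either, since the siblings that it counts are net intervals for w if and
    only if they are for w'. *)
Lemma char_vec_prefix w w' n D : (forall i, (i < n)%N -> w i = w' i) ->
  D \in net_intervals S w n -> D \in net_intervals S w' n ->
  char_vec S w n D = char_vec S w' n D.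
Proof.
move=> ww' hD hD'; rewrite /char_vec.
have DD := ltW (net_interval_lt hD).
have VE D' : D' \in net_intervals S w n -> neighbour_set S w n D' = neighbour_set S w' n D'.
  by move=> hE; apply: neighbour_set_prefix => //; exact/ltW/(net_interval_lt hE).
apply: (f_equal2 (fun V t => (norm_length S n D, V, t)) (VE _ hD)).
case: n ww' hD hD' VE => [|n] ww' hD hD' VE; rewrite /position; first by [].
have [P hP [P1 P2]] : exists2 P, P \in net_intervals S w n & P.1 <= D.1 /\ D.2 <= P.2.
  by apply: (net_interval_ancestor hullS (k := 1)); rewrite addn1.
have hP' : P \in net_intervals S w' n.
  apply: (net_interval_prefix (k := 1) hP _ _ P1 P2); last by rewrite addn1.
  by move=> i /ltnW; exact: ww'.
rewrite (parent_eq hP) ?(parent_eq hP'); try by apply/childrenP.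
congr (index _ _).+1; apply: eq_sorted_itv.
- by do 2 apply: sorted_itv_filter; exact: sorted_net_intervals.
- by do 2 apply: sorted_itv_filter; exact: sorted_net_intervals.
move=> D'; rewrite [LHS]mem_filter [RHS]mem_filter; apply/andP/andP.
  case=> /andP[/eqP eql /eqP eqV] /childrenP[hE h1 h2].
  have hE' := siblings_prefix ww' hD hD' eql eqV hE.
  rewrite eql -(VE _ hE) -(VE _ hD) eqV !eqxx; split=> //.
  exact/childrenP.
case=> /andP[/eqP eql /eqP eqV] /childrenP[hE' h1 h2].
have hE : D' \in net_intervals S w n.+1.
  by apply: (siblings_prefix _ hD' hD eql eqV hE') => i /ww'.
rewrite eql (VE _ hE) (VE _ hD) eqV !eqxx; split=> //.
exact/childrenP.
Qed.

Lemma children_similar w n P w' n' P' : similar_cells w n P w' n' P' ->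
  children S w' n' P' = [seq rescale_itv P P' D | D <- children S w n P].
Proof.
move=> sim; have [/cell_lt lt /cell_lt lt' _ _ _] := sim.
apply: eq_sorted_itv.
- by apply: sorted_itv_filter; exact: sorted_net_intervals.
- rewrite sorted_map (eq_sorted (e' := fun D D' => D.1 < D'.1)).
    by apply: sorted_itv_filter; exact: sorted_net_intervals.
  by move=> D D' /=; rewrite ltr_rescale.
have fwd u l Q u' l' Q' D : similar_cells u l Q u' l' Q' -> D \in children S u l Q ->
    rescale_itv Q Q' D \in children S u' l' Q'.
  move=> {lt lt'} sQ; have [/cell_lt lt /cell_lt lt' _ _ _] := sQ.
  case/childrenP => hD h1 h2; apply/childrenP; split.
  - by rewrite -addn1; apply: (similar_net_interval hullS sQ) => //; rewrite addn1.
  - by rewrite -(rescale_left Q Q') /= ler_rescale.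
  - by rewrite -(rescale_right Q' lt) /= ler_rescale.
move=> D; apply/idP/mapP => [hD|[D0 hD0 ->]]; last exact: (fwd _ _ _ _ _ _ _ sim).
exists (rescale_itv P' P D); first exact: (fwd _ _ _ _ _ _ _ (similar_sym sim)).
by rewrite rescale_itvK.
Qed.

(** The affine map preserves the order of the children, hence the position. The
    position of P itself is not determined by similarity, so the corresponding
    statement for P and P' can fail. *)
Lemma char_vec_similar_child w n P w' n' P' D : similar_cells w n P w' n' P' ->
  P \in net_intervals S w n -> D \in children S w n P ->
  char_vec S w' n'.+1 (rescale_itv P P' D) = char_vec S w n.+1 D.
Proof.
move=> sim hP hD; have [/cell_lt lt /cell_lt lt' _ _ _] := sim.
have hP' := similar_is_net_interval hullS sim hP.
have lE D0 : norm_length S n'.+1 (rescale_itv P P' D0) = norm_length S n.+1 D0.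
  by have := similar_norm_length 1 D0 sim; rewrite !addn1.
have VE D0 : D0 \in children S w n P ->
    neighbour_set S w' n'.+1 (rescale_itv P P' D0) = neighbour_set S w n.+1 D0.
  case/childrenP => h0 h1 h2.
  by have := similar_neighbour_set hullS 1 sim (net_interval_lt h0) h1 h2; rewrite !addn1.
rewrite /char_vec lE VE//.
apply: (f_equal (fun t => (norm_length S n.+1 D, neighbour_set S w n.+1 D, t))).
rewrite /position (parent_eq hP hD) (parent_eq hP') (children_similar sim) ?map_f//.
rewrite filter_map index_map; last exact: can_inj (rescale_itvK lt lt').
congr (index _ _).+1; apply: eq_in_filter => D0 hD0 /=.
by rewrite !lE !VE.
Qed.

(** The parent of D lies in P, and similarity passes to it. *)
Lemma char_vec_similar w n P w' n' P' k D : similar_cells w n P w' n' P' ->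
  P \in net_intervals S w n -> D \in net_intervals S w (n + k.+1) ->
  P.1 <= D.1 -> D.2 <= P.2 ->
  char_vec S w' (n' + k.+1) (rescale_itv P P' D) = char_vec S w (n + k.+1) D.
Proof.
move=> sim hP hD h1 h2; have [/cell_lt lt _ _ _ _] := sim.
have [Q hQ [q1 q2]] : exists2 Q, Q \in net_intervals S w (n + k) &
    Q.1 <= D.1 /\ D.2 <= Q.2.
  by apply: (net_interval_ancestor hullS (k := 1)); rewrite -addnA addn1.
have [p1 p2] : P.1 <= Q.1 /\ Q.2 <= P.2.
  apply: (cell_nested hullS (net_interval_cell hP) (net_interval_cell hQ));
    have := net_interval_lt hD; lra.
have simQ := similar_sub hullS sim (net_interval_cell hQ) p1 p2.
have hDQ : D \in children S w (n + k) Q by apply/childrenP; rewrite -addnS.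
rewrite !addnS -(char_vec_similar_child simQ hQ hDQ); congr (char_vec _ _ _ _).
have QQ := net_interval_lt hQ.
by rewrite /rescale_itv /rescale /=; congr pair; field;
  rewrite !subr_eq0 !gt_eqF// -subr_gt0.
Qed.

(** Endpoints and neighbours of level n depend on the first n letters only, and
    the spliced sequence has the tail that P' sees. *)
Lemma splice_similar w n P w' n' P' : cell w n P -> cell w' n' P' ->
  norm_length S n' P' = norm_length S n P ->
  neighbour_set S w' n' P' = neighbour_set S w n P ->
  similar_cells w' n' P' (splice n w (tail n' w')) n P.
Proof.
move=> cP cP' eql eqV.
have ww i : (i < n)%N -> w i = splice n w (tail n' w') i by move/splice_prefix->.
split=> //; first exact: (cell_prefix ww).
  by rewrite eqV; apply: neighbour_set_prefix => //; exact/ltW/(cell_lt cP).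
by rewrite tail_splice.
Qed.

End CharacteristicVectors.

(** * Descendants and admissible paths *)

Section Descendants.
Context {R : realType} {m : nat} (S : equicontractive_rifs R m).
Context (hullS : full_hull S).
Local Notation r := (rifs_ratio S).
Implicit Types (w : nat -> 'I_m) (n k : nat) (D P : R * R) (gamma beta : char_vector (R := R)).

Let rn_gt0 n : 0 < r ^+ n := ratio_expn_gt0 S n.

(** Only the first and last interval of a path are recorded: those in between
    are the ancestors of D. *)
Definition descendant gamma beta : Prop :=
  exists w n k P D, [/\ P \in net_intervals S w n, D \in net_intervals S w (n + k.+1),
    P.1 <= D.1, D.2 <= P.2 &
    gamma = char_vec S w n P /\ beta = char_vec S w (n + k.+1) D].

(** The net interval D of the first path ends with the vector at which the
    second path starts, so the sequence of the first can be continued with the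
    tail of the second. *)
Lemma descendant_trans gamma beta eta :
  descendant gamma beta -> descendant beta eta -> descendant gamma eta.
Proof.
move=> [w [n [k [P [D [hP hD h1 h2 [-> ->]]]]]]].
move=> [w' [n' [k' [P' [D' [hP' hD' h1' h2' [E ->]]]]]]].
pose N := (n + k.+1)%N; pose w2 := splice N w (tail n' w').
have sim : similar_cells S w' n' P' w2 N D.
  by case: E => eql eqV _; apply: splice_similar => //; exact: net_interval_cell.
have ww i : (i < N)%N -> w i = w2 i by move=> iN; rewrite /w2 splice_prefix.
have wn i : (i < n)%N -> w i = w2 i.
  by move=> ni; apply: ww; rewrite (leq_trans ni)// leq_addr.
have hD2 := similar_is_net_interval hullS sim hP'.
have hE := similar_net_interval hullS sim hD' h1' h2'.
have [/cell_lt lt' /cell_lt lt _ _ _] := sim.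
have hP2 := net_interval_prefix hullS hP wn hD2 h1 h2.
have kE : (n + (k + k'.+1).+1 = N + k'.+1)%N by rewrite /N -addnA addSn.
exists w2, n, (k + k'.+1)%N, P, (rescale_itv P' D D'); rewrite kE.
split; [exact: hP2|exact: hE| | |].
- by rewrite (le_trans h1)// -(rescale_left P' D) ler_rescale.
- by rewrite (le_trans _ h2)// -(rescale_right D lt') ler_rescale.
split; first exact: (char_vec_prefix hullS wn hP hP2).
by rewrite (char_vec_similar hullS sim).
Qed.

Lemma child_char_vec w n P D : P \in net_intervals S w n -> D \in children S w n P ->
  is_child S (char_vec S w n P) (char_vec S w n.+1 D).
Proof.
move=> hP hD; have [hD' _ _] := iffLR (childrenP hullS _ _ _ _) hD.
exists [:: w n]; split=> //; split=> //.
exists w, n, (fun i => if i is 0%N then P else D); split.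
- by case=> //= _; rewrite addn0.
- by case=> [|[|]] //= _; rewrite ?addn0 ?addn1.
- by case=> //= _; rewrite addn0.
Qed.

Lemma path_descendant gamma g :
  admissible_path S (gamma :: g) -> descendant gamma (last gamma g).
Proof.
case=> nu [nu0 [/= [sg] [w [N [Delta [_ hDelta hch]]]]]].
have nested i : (i <= size nu)%N -> (Delta 0%N).1 <= (Delta i).1 /\ (Delta i).2 <= (Delta 0%N).2.
  elim: i => [|i IHi] // lti; have [l1 l2] := IHi (ltnW lti).
  have [_ h1 h2] := iffLR (childrenP hullS _ _ _ _) (hch i lti); lra.
have [d1 d2] := nested _ (leqnn _).
have [h0 g0] := hDelta 0%N isT; have [hk gk] := hDelta _ (leqnn _).
rewrite addn0 in h0 g0; have kE : (size nu).-1.+1 = size nu by rewrite prednK.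
exists w, N, (size nu).-1, (Delta 0%N), (Delta (size nu)); rewrite kE.
split; [exact: h0|exact: hk|exact: d1|exact: d2|split]; first by case: g0.
rewrite -(@onth_nth _ gamma _ _ _ gk) -sg -[size g]/((size (gamma :: g)).-1).
by rewrite nth_last.
Qed.

(** The path consists of the ancestors of D that lie in P. *)
Lemma descendant_path gamma beta : descendant gamma beta ->
  exists g, [/\ admissible_path S (gamma :: g), last gamma g = beta &
                forall x, x \in gamma :: g -> x = gamma \/ descendant gamma x].
Proof.
move=> [w [n [k [P [D [hP hD h1 h2 [-> ->]]]]]]].
have DD := net_interval_lt hullS hD.
have anc i : exists Q : R * R, (i <= k.+1)%N ->
    Q \in net_intervals S w (n + i) /\ (Q.1 <= D.1 /\ D.2 <= Q.2).
  case: (leqP i k.+1) => ik; last by exists P.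
  have [|Q hQ QD] := @net_interval_ancestor _ _ _ hullS w (n + i) (k.+1 - i) D.
    by rewrite -addnA subnKC.
  by exists Q.
have [Delta HD] := choice anc.
have nested i j : (i <= j)%N -> (j <= k.+1)%N ->
    (Delta i).1 <= (Delta j).1 /\ (Delta j).2 <= (Delta i).2.
  move=> ij jk; have [hi [i1 i2]] := HD i (leq_trans ij jk); have [hj [j1 j2]] := HD j jk.
  apply: (cell_nested hullS (k := j - i) (net_interval_cell hullS hi)); last 2 first.
  - by lra.
  - by lra.
  by rewrite -addnA subnKC//; exact: net_interval_cell.
have D0 : Delta 0%N = P.
  have [] := HD 0%N isT; rewrite addn0 => h [? ?].
  by apply: (cell_unique hullS (net_interval_cell hullS h) (net_interval_cell hullS hP)); lra.
have Dk : Delta k.+1 = D.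
  have [h [? ?]] := HD k.+1 (leqnn _).
  by apply: (cell_unique hullS (net_interval_cell hullS h) (net_interval_cell hullS hD)); lra.
pose f i := char_vec S w (n + i) (Delta i).
have f0 : f 0%N = char_vec S w n P by rewrite /f addn0 D0.
have fk : f k.+1 = char_vec S w (n + k.+1) D by rewrite /f Dk.
have fE : char_vec S w n P :: behead (mkseq f k.+2) = mkseq f k.+2 by rewrite -f0.
exists (behead (mkseq f k.+2)); rewrite fE; split.
- exists (mkseq (fun i => w (n + i)%N) k.+1); split; first by rewrite size_mkseq.
  split; first by rewrite !size_mkseq.
  rewrite size_mkseq; exists w, n, Delta; split.
  + by move=> i ik; rewrite onthE (nth_map (w 0%N)) ?size_mkseq// nth_mkseq.
  + move=> i ik; split; first by have [] := HD i ik.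
    by rewrite onthE (nth_map (f 0%N)) ?size_mkseq// nth_mkseq.
  + move=> i ik; apply/(childrenP hullS).
    have [hi _] := HD i.+1 ik; have [? ?] := nested i i.+1 (leqnSn _) ik.
    by rewrite -addnS.
- transitivity (last (char_vec S w n P) (char_vec S w n P :: behead (mkseq f k.+2))).
    by [].
  by rewrite fE mkseqS last_rcons.
move=> x /mapP[i]; rewrite mem_iota add0n /= ltnS => ik ->.
case: i ik => [|i] ik; first by left.
right; exists w, n, i, P, (Delta i.+1).
have [hi _] := HD i.+1 ik; have [a b] := nested 0%N i.+1 isT ik.
by rewrite D0 in a b.
Qed.

Lemma is_child_descendant gamma beta : is_child S gamma beta -> descendant gamma beta.
Proof. exact: path_descendant. Qed.

Lemma descendant_closed (L : set (char_vector (R := R))) gamma beta :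
  (forall x y, L x -> is_child S x y -> L y) ->
  L gamma -> descendant gamma beta -> L beta.
Proof.
move=> cl Lg [w [n [k [P [D [hP hD h1 h2 [gE ->]]]]]]]; rewrite {}gE in Lg.
elim: k D hD h1 h2 => [|k IHk] D hD h1 h2.
  rewrite addn1; apply: cl Lg _; apply: child_char_vec => //.
  by apply/(childrenP hullS); rewrite addn1 in hD.
have [Q hQ [q1 q2]] : exists2 Q, Q \in net_intervals S w (n + k.+1) &
    Q.1 <= D.1 /\ D.2 <= Q.2.
  by apply: (net_interval_ancestor hullS (k := 1)); rewrite -addnA addn1.
have DD := net_interval_lt hullS hD.
have [p1 p2] : P.1 <= Q.1 /\ Q.2 <= P.2.
  by apply: (cell_nested hullS (net_interval_cell hullS hP) (net_interval_cell hullS hQ)); lra.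
rewrite addnS; apply: cl (IHk Q hQ p1 p2) _; apply: child_char_vec => //.
by apply/(childrenP hullS); rewrite -addnS.
Qed.

(** All neighbours of D cover D, so their translations differ by at most r^n; by
    finite type the normalized differences with a fixed neighbour lie in F. *)
Lemma neighbour_set_bounded : finite_type S ->
  exists B, forall w n D, D.1 < D.2 -> (size (neighbour_set S w n D) <= B)%N.
Proof.
case=> F [/finite_seqP[s ->] ft]; exists (size s) => w n D DD.
case E: (neighbour_set S w n D) => [//|v0 t]; rewrite -E.
have uV : uniq (neighbour_set S w n D).
  by rewrite /neighbour_set sort_uniq undup_uniq.
rewrite -(size_map (fun v => v - v0)); apply: uniq_leq_size.
  by rewrite map_inj_uniq//; exact: addIr.
move=> _ /mapP[v /(neighbour_setP _ _ _ _ (ltW DD))[c hc [vE c1 c2]] ->].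
have : v0 \in neighbour_set S w n D by rewrite E mem_head.
move/(neighbour_setP _ _ _ _ (ltW DD)) => [c0 hc0 [v0E c01 c02]].
have -> : v - v0 = (c0 - c) * r ^- n by rewrite vE v0E; ring.
move: hc hc0 => /mapP[sg hsg cE] /mapP[sg0 hsg0 c0E].
rewrite cE c0E; case: (ft _ _ _ _ hsg0 hsg) => // far; exfalso; move: far.
rewrite -cE -c0E ltNge => /negP; apply.
by rewrite ler_pdivrMr// mul1r ler_norml; apply/andP; split; lra.
Qed.

Lemma maximal_neighbour_set (w0 : nat -> 'I_m) : finite_type S ->
  exists w n P, P \in net_intervals S w n /\
    forall w' n' P', P' \in net_intervals S w' n' ->
      (size (neighbour_set S w' n' P') <= size (neighbour_set S w n P))%N.
Proof.
move=> /neighbour_set_bounded[B HB].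
pose p j := `[< exists w n P, P \in net_intervals S w n /\
                  size (neighbour_set S w n P) = j >].
have ex : exists j, p j.
  exists (size (neighbour_set S w0 0 (0, 1))); apply/asboolP.
  by exists w0, 0%N, (0, 1); split=> //=; rewrite inE.
have ub j : p j -> (j <= B)%N.
  by move=> /asboolP[w [n [P [hP <-]]]]; apply: HB; exact: (net_interval_lt hullS hP).
case: (ex_maxnP ex ub) => j /asboolP[w [n [P [hP jE]]]] max.
exists w, n, P; split=> // w' n' P' hP'; rewrite jE; apply: max.
by apply/asboolP; exists w', n', P'.
Qed.

Lemma net_interval_bounds w n P : P \in net_intervals S w n -> 0 <= P.1 /\ P.2 <= 1.
Proof.
case/(net_interval_cell hullS) => /(endpoints_bounds hullS)/andP[? _].
by move=> /(endpoints_bounds hullS)/andP[_ ?] _ _.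
Qed.

(** Let D be the copy of P0 placed at c. If a copy of level N + n0 overlaps D,
    then some net interval E in D lies in it, and E is also covered by the
    copies of all neighbours of P0. By maximality E has no further neighbour, so
    the overlapping copy is one of those. *)
Lemma maximal_copy_similar w0 n0 P0 w N c :
  P0 \in net_intervals S w0 n0 ->
  (forall w' n' P', P' \in net_intervals S w' n' ->
     (size (neighbour_set S w' n' P') <= size (neighbour_set S w0 n0 P0))%N) ->
  c \in translations S w N -> tail N w = w0 ->
  similar_cells S w0 n0 P0 w (N + n0) (c + r ^+ N * P0.1, c + r ^+ N * P0.2).
Proof.
move=> hP0 max hc wE; set D := (_, _).
have c0 := net_interval_cell hullS hP0; have lt0 := cell_lt c0.
have rN := rn_gt0 N; have rn := rn_gt0 n0; have rNn := rn_gt0 (N + n0).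
have DD : D.1 < D.2 by rewrite /= ltrD2l ltr_pM2l.
have copy c' : c' \in translations S w0 n0 ->
    c + r ^+ N * c' \in translations S w (N + n0).
  by move=> hc'; apply/translations_cat; exists c, c'; rewrite wE.
have covers c' : c' \in translations S w (N + n0) -> c' < D.2 ->
    D.1 < c' + r ^+ (N + n0) ->
    r ^- (N + n0) * (D.1 - c') \in neighbour_set S w0 n0 P0.
  move=> hc' lt1 lt2.
  (* The overlap J meets the attractor: if an end of it is an end of the copy at
     c', points accumulate there; otherwise J is all of D, which meets the
     attractor as P0 does. *)
  have [J [JJ J1 J2 Jc1 Jc2]] : exists J, [/\ meets_attractor S w J,
      D.1 <= J.1, J.2 <= D.2, c' <= J.1 & J.2 <= c' + r ^+ (N + n0)].
    case: (leP c' D.1) => [cD|Dc].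
      case: (leP D.2 (c' + r ^+ (N + n0))) => [Dc'|cD'].
        have [_ [x Kx xP]] := iffLR (net_intervalsP hullS _ _ _) hP0.
        exists D; split=> //; exists (c + r ^+ N * x).
          by apply: (attractor_copy hullS) => //; rewrite wE.
        by rewrite /D /= !ltrD2l !ltr_pM2l.
      have [|y [Ky hy]] := @attractor_left _ _ _ hullS w _ c' (c' + r ^+ (N + n0) - D.1) hc'.
        by rewrite subr_gt0.
      exists (D.1, c' + r ^+ (N + n0)); split=> //=; rewrite ?lexx ?(ltW cD')//.
      by move: hy; rewrite subKr; exists y.
    have [|y [Ky hy]] := @attractor_right _ _ _ hullS w _ c'
      (Order.min D.2 (c' + r ^+ (N + n0)) - c') hc'.
      by rewrite subr_gt0 lt_min lt1 ltrDl.
    exists (c', Order.min D.2 (c' + r ^+ (N + n0))).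
    split=> //=; rewrite ?ge_min ?lexx ?orbT ?(ltW Dc)//.
    by exists y => //=; lra.
  have [E hE [E1 E2]] := net_interval_meeting hullS (N + n0) JJ.
  have cE := net_interval_cell hullS hE; have EE := cell_lt cE.
  (* Moving the left end from D to E shifts all normalized distances equally. *)
  pose f v := v + r ^- (N + n0) * (E.1 - D.1).
  have JJ' : J.1 < J.2 by case: JJ => x _ /andP[]; exact: lt_trans.
  have sub : {subset [seq f v | v <- neighbour_set S w0 n0 P0]
                <= neighbour_set S w (N + n0) E}.
    move=> _ /mapP[v /(neighbour_setP _ _ _ _ (ltW lt0))[c1 hc1 [-> l1 l2]] ->].
    have [b1 b2] : c + r ^+ N * c1 <= E.1 /\ E.2 <= c + r ^+ N * c1 + r ^+ (N + n0).
      apply: (cell_covered cE (copy _ hc1)); rewrite ?exprD.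
        by rewrite /D /= in J1; nra.
      by rewrite /D /= in J2; nra.
    apply/(neighbour_setP _ _ _ _ (ltW EE)); exists (c + r ^+ N * c1).
      exact: copy.
    split=> //; rewrite /f /= exprD; field.
    by rewrite !gt_eqF// rifs_ratio_gt0.
  have [_ EV] : (size [seq f v | v <- neighbour_set S w0 n0 P0] =
      size (neighbour_set S w (N + n0) E)) *
      ([seq f v | v <- neighbour_set S w0 n0 P0] =i neighbour_set S w (N + n0) E).
    apply: uniq_min_size => //; last by rewrite size_map max.
    rewrite map_inj_uniq; last exact: addIr.
    by rewrite /neighbour_set sort_uniq undup_uniq.
  have [e1 e2] : c' <= E.1 /\ E.2 <= c' + r ^+ (N + n0).
    by apply: (cell_covered cE hc'); lra.
  have : r ^- (N + n0) * (E.1 - c') \in neighbour_set S w (N + n0) E.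
    by apply/(neighbour_setP _ _ _ _ (ltW EE)); exists c'.
  rewrite -EV => /mapP[v hv vE]; suff -> : r ^- (N + n0) * (D.1 - c') = v by [].
  have -> : v = r ^- (N + n0) * (E.1 - c') - r ^- (N + n0) * (E.1 - D.1).
    by rewrite vE /f addrK.
  by ring.
have covered c' : c' \in translations S w (N + n0) -> c' < D.2 ->
    D.1 < c' + r ^+ (N + n0) -> c' <= D.1 /\ D.2 <= c' + r ^+ (N + n0).
  move=> hc' lt1 lt2; have := covers _ hc' lt1 lt2.
  case/(neighbour_setP _ _ _ _ (ltW lt0)) => c1 _ [E l1 l2].
  have c'E : c' = c + r ^+ N * c1.
    have -> : c' = D.1 - r ^+ (N + n0) * (r ^- (N + n0) * (D.1 - c')).
      by rewrite mulVKf ?gt_eqF//; ring.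
    rewrite E /= exprD; field.
    by rewrite !gt_eqF// rifs_ratio_gt0.
  by rewrite c'E /= exprD; split; nra.
have [P1 P2 _ _] := c0.
have endp e : e \in endpoints S w0 n0 -> c + r ^+ N * e \in endpoints S w (N + n0).
  case/endpointsP => c1 hc1 [->|->]; apply/endpointsP; exists (c + r ^+ N * c1).
  - exact: copy.
  - by left.
  - exact: copy.
  - by right; rewrite exprD; ring.
split=> //.
- split=> //; try exact: endp.
  move=> e /endpointsP[c' hc' eE] De; rewrite leNgt; apply/negP => eD.
  have [||] := covered _ hc'; case: eE => eE; rewrite -?eE; lra.
- by rewrite /norm_length /= exprD; field; rewrite !gt_eqF// rifs_ratio_gt0.
- apply: lt_sorted_eq; rewrite ?sorted_neighbour_set// => v; apply/idP/idP.
    case/(neighbour_setP _ _ _ _ (ltW lt0)) => c1 hc1 [-> l1 l2].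
    apply/(neighbour_setP _ _ _ _ (ltW DD)); exists (c + r ^+ N * c1); first exact: copy.
    split.
    - by rewrite /= exprD; field; rewrite !gt_eqF// rifs_ratio_gt0.
    - by rewrite /= lerD2l ler_pM2l.
    - by rewrite /= exprD -addrA -mulrDr lerD2l ler_pM2l.
  by case/(neighbour_setP _ _ _ _ (ltW DD)) => c1 hc1 [-> l1 l2]; apply: covers => //; lra.
- by rewrite -tail_tail wE.
Qed.

(** A copy of level n + k inside P is found around a point of the attractor; P0
    is transplanted into it, and any child of P0 will do. *)
Lemma universal_descendant (w0 : nat -> 'I_m) : finite_type S ->
  exists delta, char_vectors S delta /\
    forall gamma, char_vectors S gamma -> descendant gamma delta.
Proof.
move=> /(maximal_neighbour_set w0)[{}w0 [n0 [P0 [hP0 max]]]].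
have [D0 hD0 [d1 d2]] := net_interval_child hullS hP0.
exists (char_vec S w0 n0.+1 D0); split; first by exists w0, n0.+1, D0.
move=> _ [w [n [P [hP ->]]]].
have [_ [x Kx /andP[Px xP]]] := iffLR (net_intervalsP hullS _ _ _) hP.
have [|k rk] := @ratio_expn_small _ _ S (Order.min (x - P.1) (P.2 - x)).
  by rewrite lt_min !subr_gt0 Px xP.
move: rk; rewrite lt_min => /andP[rk1 rk2].
have rnk : r ^+ (n + k) <= r ^+ k.
  by rewrite ler_wiXn2l ?leq_addl// ltW// (rifs_ratio_gt0, rifs_ratio_lt1).
have [c [y [hc Ky xE]]] := iffLR (attractor_cat hullS w (n + k) x) Kx.
have /andP[y0 y1] := attractor_bounds hullS Ky; have rp := rn_gt0 (n + k).
pose w' := splice (n + k) w w0.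
have ww i : (i < n + k)%N -> w i = w' i by move=> ik; rewrite /w' splice_prefix.
have wn i : (i < n)%N -> w i = w' i.
  by move=> ni; apply: ww; rewrite (leq_trans ni)// leq_addr.
have hc' : c \in translations S w' (n + k) by rewrite -(translations_prefix S ww).
have := maximal_copy_similar hP0 max hc' (tail_splice _ _ _).
set D := (_, _) => sim.
have [b0 b1] := net_interval_bounds hP0; have lt0 := net_interval_lt hullS hP0.
have [D1 D2] : P.1 <= D.1 /\ D.2 <= P.2 by rewrite /D /=; split; nra.
have hD : D \in net_intervals S w' (n + (k + n0)).
  by rewrite addnA; apply: (similar_is_net_interval hullS sim hP0).
have hP' := net_interval_prefix hullS hP wn hD D1 D2.
have hD0' : D0 \in net_intervals S w0 (n0 + 1) by rewrite addn1.
have lt := net_interval_lt hullS hD.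
exists w', n, (k + n0)%N, P, (rescale_itv P0 D D0).
have kE : (n + (k + n0).+1 = n + k + n0 + 1)%N by rewrite addn1 addnS addnA.
rewrite kE; split; [exact: hP'|exact: (similar_net_interval hullS sim)| | |].
- by rewrite (le_trans D1)// -(rescale_left P0 D) ler_rescale.
- by rewrite (le_trans _ D2)// -(rescale_right D lt0) ler_rescale.
split; first exact: (char_vec_prefix hullS wn hP hP').
by rewrite (char_vec_similar hullS (k := 0) sim hP0 hD0')// addn1.
Qed.

End Descendants.

Theorem proposition4p17 (R : realType) (m : nat) (m_ge1 : (1 <= m)%N)
    (S : equicontractive_rifs R m) (hullS : full_hull S) (ftS : finite_type S) :
  exists! L : set (char_vector (R := R)), essential_class S L.
Proof.
have [delta [hd univ]] := universal_descendant hullS (fun=> Ordinal m_ge1) ftS.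
pose L : set (char_vector (R := R)) := [set beta | descendant S delta beta].
have LV : L `<=` char_vectors S.
  by move=> _ [w [n [k [P [D [_ hD _ _ [_ ->]]]]]]]; exists w, (n + k.+1)%N, D.
have closedL gamma beta : L gamma -> descendant S gamma beta -> L beta.
  exact: descendant_trans.
exists L; split.
  split; last by move=> gamma beta Lg /(is_child_descendant hullS); exact: closedL.
  split=> //; first by exists delta; exact: univ.
  move=> gamma beta Lg Lb.
  have gb : descendant S gamma beta by apply: (descendant_trans hullS (univ _ (LV _ Lg)) Lb).
  have [g [path_g last_g sub_g]] := descendant_path hullS gb.
  by exists g; split=> // x /sub_g[->//|]; exact: closedL.
move=> L' [[L'V [gamma L'g] loop] cl].
have L'd : L' delta := descendant_closed hullS cl L'g (univ _ (L'V _ L'g)).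
apply/seteqP; split=> beta; first exact: (descendant_closed hullS cl L'd).
move=> L'b; have [g [path_g <- _]] := loop _ _ L'd L'b.
exact: (path_descendant hullS path_g).
Qed.
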